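(* Let $R$ be a principal ideal domain. The following are equivalent: (1) $R$ admits a positively expansive automorphism; (2) the identity automorphism of $R$ is expansive; (3) $R$ has finitely many maximal ideals.
   Context: A generator of a commutative unital ring $R$ is a finite set $\mathcal I$ of ideals of $R$ with $\sum_{I\in\mathcal I}I=R$. The product of generators is $\mathcal I\mathcal J=\{IJ\mid I\in\mathcal I,\,J\in\mathcal J\}$, and similarly for finitely many factors. For families of sets, $\mathcal A\prec\mathcal B$ means that for every $A\in\mathcal A$ there is $B\in\mathcal B$ with $A\subseteq B$. For a ring automorphism $\alpha\colon R\to R$ and $i\in\mathbb Z$, $\alpha^{i}(\mathcal I)=\{\alpha^{i}(I)\mid I\in\mathcal I\}$. An automorphism $\alpha$ of $R$ is expansive if there is a generator $\mathcal I$ such that for every generator $\mathcal J$ there is $N\ge 0$ with $\prod_{|i|\le N}\alpha^{-i}(\mathcal I)\prec\mathcal J$. It is positively expansive if there is a generator $\mathcal I$ such that for every generator $\mathcal J$ there is $N\ge 0$ with $\prod_{i=0}^N\alpha^{-i}(\mathcal I)\prec\mathcal J$. *)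

(* Defs.v *)
From HB Require Import structures.
From mathcomp Require Import all_boot all_order all_algebra.
From mathcomp Require Import boolp classical_sets functions cardinality fsbigop.

Set Implicit Arguments.
Unset Strict Implicit.
Unset Printing Implicit Defensive.

Import GRing.Theory.
Local Open Scope classical_set_scope.
Local Open Scope ring_scope.

Section Ideals.
Variable R : comPzRingType.
Implicit Types (I J M : set R) (F G : set (set R)).

(* The improper ideal is allowed, unlike in [idealr_closed] of ring_quotient. *)
Definition is_ideal I : Prop :=
  [/\ I 0,
      forall x y, I x -> I y -> I (x + y)
    & forall a x, I x -> I (a * x)].

Definition principal_ideal (a : R) : set R := [set a * x | x in [set: R]].

Definition maximal_ideal M : Prop :=
  [/\ is_ideal M, M <> [set: R]
    & forall I, is_ideal I -> M `<=` I -> I = M \/ I = [set: R]].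

(* IJ: finite sums of products xy with x in I and y in J. *)
Definition ideal_mul I J : set R :=
  [set z | exists2 s : seq (R * R),
     (forall p, p \in s -> I p.1 /\ J p.2) & z = \sum_(p <- s) p.1 * p.2].

(* Sums of one element from each member of F; meant for finite F only, as the *)
(* finitely supported sum is 0 by convention when its support is infinite.    *)
Definition ideal_sum F : set R :=
  [set z | exists2 f : set R -> R,
     (forall I, F I -> I (f I)) & z = \sum_(I \in F) f I].

Definition generator F : Prop :=
  [/\ finite_set F, F `<=` is_ideal & ideal_sum F = [set: R]].

Definition gen_mul F G : set (set R) :=
  [set ideal_mul I J | I in F & J in G].

(* The neutral factor is {R}: IR = I for every ideal I. *)
Definition gen_prod (s : seq (set (set R))) : set (set R) :=
  \big[gen_mul/[set [set: R]]]_(F <- s) F.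

End Ideals.

Definition refines (T : Type) (A B : set (set T)) : Prop :=
  forall X, A X -> exists2 Y, B Y & X `<=` Y.

Record ring_aut (R : pzRingType) := RingAut {
  aut_fun :> {rmorphism R -> R};
  aut_inv : R -> R;
  aut_funK : cancel aut_fun aut_inv;
  aut_invK : cancel aut_inv aut_fun
}.

Definition id_aut (R : pzRingType) : ring_aut R :=
  @RingAut R idfun idfun (fun _ => erefl) (fun _ => erefl).

Definition aut_iter (R : pzRingType) (alpha : ring_aut R) (i : int) : R -> R :=
  match i with
  | Posz n => iter n alpha
  | Negz n => iter n.+1 (aut_inv alpha)
  end.

Definition aut_gen (R : pzRingType) (alpha : ring_aut R) (i : int)
    (F : set (set R)) : set (set R) :=
  [set aut_iter alpha i @` I | I in F].

Definition expansive (R : comPzRingType) (alpha : ring_aut R) : Prop :=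
  exists2 F : set (set R), generator F &
    forall G : set (set R), generator G -> exists N : nat,
      refines
        (gen_prod [seq aut_gen alpha (- (k%:Z - N%:Z)) F | k <- iota 0 N.*2.+1])
        G.

Definition positively_expansive (R : comPzRingType) (alpha : ring_aut R) : Prop :=
  exists2 F : set (set R), generator F &
    forall G : set (set R), generator G -> exists N : nat,
      refines (gen_prod [seq aut_gen alpha (- k%:Z) F | k <- iota 0 N.+1]) G.

Definition principal_ideal_domain (R : idomainType) : Prop :=
  forall I : set R, is_ideal I -> exists a : R, I = principal_ideal a.

(* Main.v *)
Require Import Defs.
From HB Require Import structures.
From mathcomp Require Import all_boot all_order all_algebra.
From mathcomp Require Import boolp classical_sets functions cardinality fsbigop.

Set Implicit Arguments.
Unset Strict Implicit.
Unset Printing Implicit Defensive.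

Import GRing.Theory.
Local Open Scope classical_set_scope.
Local Open Scope ring_scope.

(* If the maximal ideals M_1, ..., M_n are finitely many, M_i = (p_i), let    *)
(* a_i be the product of the p_j with j <> i, and F = {(a_1), ..., (a_n)}.    *)
(* Given a generator G, each i has a member of G not contained in M_i; as a_i *)
(* lies in every other maximal ideal, a power of a_i lies in that member.  By *)
(* the pigeonhole principle a long product of members of F is contained in    *)
(* a high power of some (a_i), so the identity is (positively) expansive.     *)
(* Conversely, let F witness that alpha is positively expansive, let x <> 0   *)
(* belong to a member of F, and let V be the finite set of maximal ideals     *)
(* containing x.  Refining the generator {M, N} for distinct maximal M and N  *)
(* puts alpha^k(M) or alpha^k(N) in V for some k >= 0, so all maximal ideals  *)
(* but at most one are in the backward orbits of V.  Points of V must then be *)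
(* periodic, so these backward orbits are finite.                             *)

(** Generators are handled through [generator_maximalP]: a finite set of ideals generates exactly
    when no maximal ideal contains all its members. Expansiveness thus becomes a question about
    maximal ideals and the action of alpha on them. Two facts about a PID feed the argument, both
    drawn from the ascending chain condition [pid_maximal_member]: a nonzero x lies in only finitely
    many maximal ideals ([pid_maximal_containing_finite]), and an element common to all of these has
    a power divisible by x ([pid_power_mem_principal]). The second yields [semilocal_generator]; the
    first yields [positively_expansive_semilocal], by way of the purely dynamical
    [finite_backward_orbits]. The cycle closes because, for the identity, both kinds of
    expansiveness speak of long powers of one generator. *)

Lemma principal_ideal_ideal (R : comPzRingType) (a : R) :
  is_ideal (principal_ideal a).
Proof.
split=> [|_ _ [x _ <-] [y _ <-]|b _ [x _ <-]].
- by exists 0; rewrite ?mulr0.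
- by exists (x + y); rewrite ?mulrDr.
- by exists (b * x) => //; rewrite mulrCA.
Qed.

Lemma mem_principal_ideal (R : comPzRingType) (a : R) : principal_ideal a a.
Proof. by exists 1; rewrite ?mulr1. Qed.

Lemma principal_ideal_sub (R : comPzRingType) (I : set R) (a : R) :
  is_ideal I -> I a -> principal_ideal a `<=` I.
Proof. by case=> _ _ IM Ia _ [x _ <-]; rewrite mulrC; exact: IM. Qed.

Lemma is_ideal_sum (R : comPzRingType) (I : set R) (T : eqType) (s : seq T)
    (f : T -> R) :
  is_ideal I -> (forall i, i \in s -> I (f i)) -> I (\sum_(i <- s) f i).
Proof.
case=> I0 ID _ If; rewrite big_seq.
by elim/big_ind: _ => // i; exact: If.
Qed.

Lemma ideal_eqT (R : comPzRingType) (I : set R) :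
  is_ideal I -> I 1 -> I = [set: R].
Proof.
case=> _ _ IM I1; apply/seteqP; split=> // x _.
by rewrite -[x]mulr1; exact: IM.
Qed.

Lemma maximal_ideal_proper (R : comPzRingType) (M : set R) :
  maximal_ideal M -> ~ M 1.
Proof. by case=> Mid MT _ M1; apply: MT; exact: ideal_eqT. Qed.

(** By maximality M + Rx is M or R; in the latter case multiply 1 = m + ax by y. *)
Lemma maximal_ideal_prime (R : comPzRingType) (M : set R) (x y : R) :
  maximal_ideal M -> M (x * y) -> M x \/ M y.
Proof.
move=> maxM Mxy; have [Mid MT Mmax] := maxM; have [M0 MD MM] := Mid.
pose I := [set z | exists2 m, M m & exists a, z = m + a * x].
have Iid : is_ideal I.
  split=> [|_ _ [m Mm [a ->]] [n Mn [b ->]]|c _ [m Mm [a ->]]].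
  - by exists 0 => //; exists 0; rewrite mul0r addr0.
  - by exists (m + n); [exact: MD|exists (a + b); rewrite mulrDl addrACA].
  - by exists (c * m); [exact: MM|exists (c * a); rewrite mulrDr mulrA].
have MI : M `<=` I by move=> m Mm; exists m => //; exists 0; rewrite mul0r addr0.
have [IM|IT] := Mmax I Iid MI.
  by left; rewrite -IM; exists 0 => //; exists 1; rewrite add0r mul1r.
have [m Mm [a e1]] : I 1 by rewrite IT.
right; rewrite -[y]mul1r e1 mulrDl -mulrA [m * y]mulrC.
by apply: MD; exact: MM.
Qed.

Lemma maximal_ideal_prod (R : comPzRingType) (M : set R) (T : eqType)
    (s : seq T) (f : T -> R) :
  maximal_ideal M -> M (\prod_(i <- s) f i) -> exists2 i, i \in s & M (f i).
Proof.
move=> maxM; elim: s => [|i s IHs].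
  by rewrite big_nil => /(maximal_ideal_proper maxM).
rewrite big_cons => /(maximal_ideal_prime maxM)[Mi|/IHs[j js Mj]].
  by exists i; rewrite ?mem_head.
by exists j => //; rewrite in_cons js orbT.
Qed.

Lemma maximal_ideal_sub_eq (R : comPzRingType) (M N : set R) :
  maximal_ideal M -> maximal_ideal N -> M `<=` N -> M = N.
Proof. by move=> [_ _ Mmax] [Nid NT _] /(Mmax _ Nid)[]. Qed.

Lemma mem_ideal_sum (R : comPzRingType) (F : set (set R)) (I : set R) :
  finite_set F -> F `<=` @is_ideal R -> F I -> I `<=` ideal_sum F.
Proof.
move=> finF Fid FI x Ix; exists (fun J => if J == I then x else 0).
  by move=> J FJ; case: eqP => [->//|_]; have [] := Fid J FJ.
rewrite (fsbigD1 I) //= ?eqxx ?fsbig1 ?addr0 //.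
by move=> J [_ /eqP/negbTE ->].
Qed.

Lemma ideal_sum_ideal (R : comPzRingType) (F : set (set R)) :
  finite_set F -> F `<=` @is_ideal R -> is_ideal (ideal_sum F).
Proof.
move=> finF Fid; split.
- by exists (fun=> 0); [move=> I /Fid[]|rewrite fsbig1].
- move=> _ _ [f Ff ->] [g Fg ->]; exists (fun I => f I + g I).
    by move=> I FI; have [_ ID _] := Fid I FI; apply: ID; [exact: Ff|exact: Fg].
  by rewrite !fsbig_finite //= big_split.
- move=> a _ [f Ff ->]; exists (fun I => a * f I).
    by move=> I FI; have [_ _ IM] := Fid I FI; apply: IM; exact: Ff.
  by rewrite !fsbig_finite //= big_distrr.
Qed.

(** * Chain conditions and maximal ideals in a PID *)

(** The union of a nonempty chain in P is an ideal (d), and a member containing d is already the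
    whole union, so Zorn's lemma applies. *)
Lemma pid_maximal_member (R : idomainType) (P : set (set R)) :
  principal_ideal_domain R -> P `<=` @is_ideal R -> P !=set0 ->
  exists2 A, P A & forall B, P B -> A `<=` B -> B = A.
Proof.
move=> hR Pid [A0 PA0].
(* The empty set is adjoined because it is the union of the empty chain. *)
have [|A [QA Amax]] := @Zorn_bigcup R (P `|` [set set0]).
  move=> F FQ Ftot; have [[A FA PA]|noA] := pselect (exists2 A, F A & P A); last first.
    right; rewrite /= -subset0 => x [A FA Ax].
    have [PA|A0'] := FQ _ FA; first by case: noA; exists A.
    by move: Ax; rewrite A0'.
  have Fid (B : set R) x : F B -> B x -> is_ideal B.
    by move=> FB Bx; have [/Pid//|B0] := FQ _ FB; move: Bx; rewrite B0.
  have [A0' _ _] := Pid _ PA.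
  set U := \bigcup_(B in F) B.
  have Uid : is_ideal U.
    split; first by exists A.
    - move=> x y [B FB Bx] [C FC Cy].
      have [BC|CB] := Ftot _ _ FB FC.
        exists C => //; have [_ CD _] := Fid _ _ FC Cy.
        by apply: CD => //; exact: BC.
      exists B => //; have [_ BD _] := Fid _ _ FB Bx.
      by apply: BD => //; exact: CB.
    - move=> a x [B FB Bx]; exists B => //.
      by have [_ _ BM] := Fid _ _ FB Bx; exact: BM.
  left; have [d Ud] := hR _ Uid.
  have [B FB Bd] : U d by rewrite Ud; exact: mem_principal_ideal.
  have -> : U = B.
    apply/seteqP; split; last by move=> x Bx; exists B.
    by rewrite Ud; apply: principal_ideal_sub => //; exact: (Fid _ d).
  by have [//|B0] := FQ _ FB; move: Bd; rewrite B0.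
have {QA}PA : P A.
  case: QA => // A_0; have [A00 _ _] := Pid _ PA0.
  case: (Amax A0); last by left.
  by rewrite A_0; split=> // /(_ _ A00).
exists A => // B PB AB; apply/seteqP; split=> //.
by apply: contrapT => BA; apply: (Amax B); [split|left].
Qed.

Lemma pid_exists_maximal (R : idomainType) (I : set R) :
  principal_ideal_domain R -> is_ideal I -> ~ I 1 ->
  exists2 M, maximal_ideal M & I `<=` M.
Proof.
move=> hR Iid I1.
pose P := [set J : set R | [/\ is_ideal J, I `<=` J & ~ J 1]].
have [||M [Mid IM M1] Mmax] := @pid_maximal_member R P hR.
- by move=> J [].
- by exists I; split.
exists M => //; split=> // [MT|J Jid MJ]; first by apply: M1; rewrite MT.
have [J1|J1] := pselect (J 1); first by right; exact: ideal_eqT.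
by left; apply: Mmax => //; split=> //; exact: subset_trans IM MJ.
Qed.

(** A sum of ideals is proper exactly when some maximal ideal contains every summand. *)
Lemma generator_maximalP (R : idomainType) (F : set (set R)) :
  principal_ideal_domain R -> finite_set F -> F `<=` @is_ideal R ->
  generator F <->
  forall M, maximal_ideal M -> exists2 I, F I & exists2 x, I x & ~ M x.
Proof.
move=> hR finF Fid; split=> [[_ _ FT] M maxM|Fmax].
  apply: contrapT => noI; apply: (maximal_ideal_proper maxM).
  have [f Ff ->] : ideal_sum F 1 by rewrite FT.
  rewrite fsbig_finite //=; apply: is_ideal_sum; first by case: maxM.
  move=> I; rewrite in_fset_set // inE => FI; apply: contrapT => MfI.
  by apply: noI; exists I => //; exists (f I) => //; exact: Ff.
have Sid := ideal_sum_ideal finF Fid.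
split=> //; apply: ideal_eqT => //; apply: contrapT => S1.
have [M maxM SM] := pid_exists_maximal hR Sid S1.
have [I FI [x Ix]] := Fmax M maxM; apply; apply: SM.
exact: mem_ideal_sum FI _ Ix.
Qed.

(** Noetherian induction: let A = (a) be maximal among the nonzero ideals with infinitely many
    maximal ideals above them, and write a = p b with (p) maximal. By primality a maximal ideal
    above A is (p) or lies above (b), and only finitely many lie above (b). *)
Lemma pid_maximal_containing_finite (R : idomainType) (x : R) :
  principal_ideal_domain R -> x != 0 ->
  finite_set [set M | maximal_ideal M /\ M x].
Proof.
move=> hR x0; apply: contrapT => infx.
pose above (J : set R) := [set M | maximal_ideal M /\ J `<=` M].
pose P := [set J | [/\ is_ideal J, exists2 r, J r & r != 0
                     & ~ finite_set (above J)]].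
have [||A [Aid [r Ar r0] infA] Amax] := @pid_maximal_member R P hR.
- by move=> J [].
- exists (principal_ideal x); split; first exact: principal_ideal_ideal.
    by exists x => //; exact: mem_principal_ideal.
  apply: contra_not infx; apply: sub_finite_set => M [maxM Mx]; split=> //.
  by apply: principal_ideal_sub => //; case: maxM.
have [a Aa] := hR A Aid; have Aa' : A a by rewrite Aa; exact: mem_principal_ideal.
have a0 : a != 0.
  apply: contraNneq r0 => a0; move: Ar.
  by rewrite Aa => -[u _ <-]; rewrite a0 mul0r.
have [M [maxM AM]] : above A !=set0.
  by apply: contrapT => /set0P/negP/negPn/eqP A0; apply: infA; rewrite A0.
have [p Mp] : exists p, M = principal_ideal p by apply: hR; case: maxM.
have [b _ pb] : principal_ideal p a by rewrite -Mp; exact: AM.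
(* (b) strictly contains A = (p b), so maximality of A applies to it. *)
have finB : finite_set (above (principal_ideal b)).
  apply: contrapT => infB; have AB : A `<=` principal_ideal b.
    rewrite Aa; apply: principal_ideal_sub; first exact: principal_ideal_ideal.
    by exists p; rewrite // mulrC.
  have PB : P (principal_ideal b).
    split=> //; first exact: principal_ideal_ideal.
    by exists r => //; exact: AB.
  have [u _ ub] : principal_ideal a b.
    by rewrite -Aa -(Amax _ PB AB); exact: mem_principal_ideal.
  apply: (maximal_ideal_proper maxM); rewrite Mp; exists u => //.
  by apply: (mulfI a0); rewrite mulr1 mulrCA ub.
apply: infA; apply: (@sub_finite_set _ _ (M |` above (principal_ideal b))).
  move=> N [maxN AN]; have [Nid _ _] := maxN.
  have /(maximal_ideal_prime maxN)[Np|Nb] : N (p * b) by rewrite pb; exact: AN.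
    left; apply/esym/maximal_ideal_sub_eq => //.
    by rewrite Mp; exact: principal_ideal_sub.
  by right; split=> //; exact: principal_ideal_sub.
by rewrite finite_setU; split.
Qed.

(** The colon ideals (x) : a^k increase with k, hence stabilise at some k. If the stable ideal (y)
    were proper, a maximal ideal (p) above it would contain x, hence a; dividing y by p would then
    stay in (y), making p a unit. *)
Lemma pid_power_mem_principal (R : idomainType) (x a : R) :
  principal_ideal_domain R -> x != 0 ->
  (forall M, maximal_ideal M -> M x -> M a) ->
  exists k, principal_ideal x (a ^+ k).
Proof.
move=> hR x0 xa; have [X0 XD XM] := principal_ideal_ideal x.
pose I k := [set r | principal_ideal x (r * a ^+ k)].
have Iid k : is_ideal (I k).
  split=> [|r s rI sI|b r rI] /=; rewrite /I /=.
  - by rewrite mul0r.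
  - by rewrite mulrDl; exact: XD.
  - by rewrite -mulrA; exact: XM.
have [||_ [k _ <-] Imax] := @pid_maximal_member R (range I) hR.
- by move=> _ [k _ <-].
- by exists (I 0%N), 0%N.
have Ik1 : I k.+1 = I k.
  apply: Imax; first by exists k.+1.
  by move=> r; rewrite /I /= exprS mulrCA; exact: XM.
exists k; rewrite -[_ ^+ _]mul1r; apply: contrapT => I1.
have [M maxM IM] := pid_exists_maximal hR (Iid k) I1.
have [p Mp] : exists p, M = principal_ideal p by apply: hR; case: maxM.
have Ix : I k x by exists (a ^+ k).
have [y Iy] := hR _ (Iid k).
have Iky : I k y by rewrite Iy; exact: mem_principal_ideal.
have y0 : y != 0.
  apply: contraNneq x0 => y0; move: Ix.
  by rewrite Iy => -[u _ <-]; rewrite y0 mul0r.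
have [y' _ py] : principal_ideal p y by rewrite -Mp; exact: IM.
have [a' _ pa] : principal_ideal p a by rewrite -Mp; apply: xa => //; exact: IM.
(* With y = p y' and a = p a', y' a^(k+1) = a' (y a^k) is a multiple of x. *)
have : I k y'.
  rewrite -Ik1 /I /= exprS -{1}pa mulrA [y' * _]mulrA [y' * p]mulrC py.
  by rewrite [y * a']mulrC -mulrA; exact: XM.
rewrite Iy => -[u _ yu]; apply: (maximal_ideal_proper maxM).
rewrite Mp; exists u => //; apply: (mulfI y0).
by rewrite mulr1 mulrCA yu py.
Qed.

(** * Powers of a generator when there are finitely many maximal ideals *)

Lemma size_sum_count (T : eqType) (s t : seq T) :
  uniq s -> {subset t <= s} -> size t = (\sum_(i <- s) count_mem i t)%N.
Proof.
move=> us; elim: t => [|x t IHt] ts; first by rewrite big1.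
rewrite /= big_split /= -IHt; last by move=> i ti; apply: ts; rewrite in_cons ti orbT.
rewrite (eq_bigr (fun i => if i == x then 1%N else 0%N)); last first.
  by move=> i _; rewrite eq_sym; case: (i == x).
by rewrite -big_mkcond sum1_count count_uniq_mem // ts ?mem_head.
Qed.

(** The word t records which principal ideal was chosen in each of the n factors. *)
Lemma gen_prod_nseq_principal (R : comPzRingType) (T : eqType) (s : seq T)
    (f : T -> R) (n : nat) (P : set R) :
  gen_prod (nseq n [set principal_ideal (f i) | i in [set` s]]) P ->
  exists t, [/\ size t = n, {subset t <= s}
             & P `<=` principal_ideal (\prod_(i <- t) f i)].
Proof.
rewrite /gen_prod; elim: n P => [|n IHn] P /=.
  rewrite big_nil => ->; exists [::]; split=> // x _.
  by exists x; rewrite ?big_nil ?mul1r.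
rewrite big_cons => -[_ [i si <-]] [J /IHn[t [tn ts Jt]] <-].
exists (i :: t); split=> /=; first by rewrite tn.
  by move=> j; rewrite in_cons => /predU1P[->|/ts].
move=> _ [l lIJ ->]; apply: is_ideal_sum; first exact: principal_ideal_ideal.
move=> p /lIJ[[u _ <-] /Jt[v _ <-]].
by exists (u * v); rewrite // big_cons mulrACA.
Qed.

Lemma expr_count_dvd_prod (R : comPzRingType) (T : eqType) (t : seq T)
    (f : T -> R) (i : T) (k : nat) : (k <= count_mem i t)%N ->
  exists c, \prod_(j <- t) f j = c * f i ^+ k.
Proof.
move=> kt; rewrite (bigID (pred1 i)) /=.
rewrite (eq_bigr (fun=> f i)) => [|j /eqP -> //].
rewrite big_const_seq iter_mulr_1 -(subnK kt) exprD mulrAC.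
by eexists; reflexivity.
Qed.

(** Stated for all large n, without an automorphism, so that it serves one-sided and two-sided
    windows alike. *)
Lemma semilocal_generator (R : idomainType) :
  principal_ideal_domain R -> finite_set [set M : set R | maximal_ideal M] ->
  exists2 F : set (set R), generator F &
    forall G, generator G -> exists K, forall n, (K <= n)%N ->
      refines (gen_prod (nseq n F)) G.
Proof.
move=> hR /finite_seqP[s0 s0E]; pose s := undup s0.
have sE M : maximal_ideal M <-> M \in s.
  by rewrite mem_undup; have := congr1 (fun A : set (set R) => A M) s0E => /= ->.
have /choice[p pE] : forall M : set R, exists q,
    maximal_ideal M -> M = principal_ideal q.
  move=> M; have [maxM|] := pselect (maximal_ideal M); last by exists 0.
  by have [q Mq] : exists q, M = principal_ideal q; [apply: hR; case: maxM|exists q].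
have pM M : maximal_ideal M -> M (p M).
  by move=> maxM; rewrite [X in X _]pE //; exact: mem_principal_ideal.
pose a M := \prod_(N <- [seq N <- s | N != M]) p N.
have aM M : maximal_ideal M -> ~ M (a M).
  move=> maxM /(maximal_ideal_prod maxM)[N]; rewrite mem_filter => /andP[/eqP NM].
  move=> /sE maxN MpN; apply: NM; apply: maximal_ideal_sub_eq => //.
  by rewrite [N]pE //; apply: principal_ideal_sub => //; case: maxM.
have aN M N : maximal_ideal N -> N <> M -> N (a M).
  move=> maxN NM; rewrite /a (big_rem N) /=; last first.
    by rewrite mem_filter; apply/andP; split; [apply/eqP|apply/sE].
  have [[_ _ NMul] _ _] := maxN.
  by rewrite mulrC; apply: NMul; exact: pM.
pose F := [set principal_ideal (a M) | M in [set` s]].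
have Fid : F `<=` @is_ideal R by move=> _ [M _ <-]; exact: principal_ideal_ideal.
exists F.
  apply/generator_maximalP => //; first exact: finite_image.
  move=> M maxM; exists (principal_ideal (a M)); first by exists M => //; apply/sE.
  by exists (a M); [exact: mem_principal_ideal|exact: aM].
move=> G genG; have [finG Gid _] := genG.
have /choice[k kG] : forall M : set R, exists k,
    M \in s -> exists2 I, G I & I (a M ^+ k).
  move=> M; have [Ms|] := boolP (M \in s); last by exists 0%N.
  have /sE maxM := Ms.
  have [I GI [y Iy My]] := (generator_maximalP hR finG Gid).1 genG M maxM.
  have y0 : y != 0.
    by apply: contra_notN My => /eqP ->; have [[]] := maxM.
  (* A maximal ideal containing y differs from M, hence contains [a M]. *)
  have [N maxN Ny|k yk] := @pid_power_mem_principal R y (a M) hR y0.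
    by apply: aN => // NM; apply: My; rewrite -NM.
  by exists k => _; exists I => //; apply: principal_ideal_sub yk => //; exact: Gid.
(* If every M occurred fewer than [k M] times in t, the length of t would be at most the sum of the
   exponents; the successor rules this out. *)
exists (\sum_(M <- s) k M).+1 => n Kn P /gen_prod_nseq_principal[t [tn ts Pt]].
have [M Ms kt] : exists2 M, M \in s & (k M <= count_mem M t)%N.
  apply: contrapT => noM; move: Kn; apply/negP; rewrite -leqNgt -tn.
  rewrite (size_sum_count (undup_uniq _) ts) !big_seq leq_sum // => M Ms.
  by rewrite leqNgt; apply: contra_notN noM => /ltnW ?; exists M.
have [I GI IM] := kG M Ms; exists I => //; have [_ _ Imul] := Gid I GI.
apply: (subset_trans Pt); apply: principal_ideal_sub; first exact: Gid.
by have [c ->] := expr_count_dvd_prod a kt; exact: Imul.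
Qed.

(** * Dynamics of an injective map whose forward orbits meet a finite set *)

Lemma iter_inj (X : Type) (T : X -> X) (n : nat) :
  injective T -> injective (iter n T).
Proof. by move=> injT; elim: n => //= n IHn x y /injT/IHn. Qed.

(* If [v] is not periodic, its forward orbit meets the finite set [V] only    *)
(* finitely often, so two late points of it violate the covering hypothesis.  *)
Lemma orbit_periodic (X : Type) (D V : set X) (T : X -> X) (v : X) :
  injective T -> finite_set V -> {homo T : x / D x} ->
  (forall x y, D x -> D y -> x <> y -> exists k, V (iter k T x) \/ V (iter k T y)) ->
  D v -> exists2 p, (0 < p)%N & iter p T v = v.
Proof.
move=> injT finV TD cover Dv; apply: contrapT => aperiodic.
have inj_orbit : injective (fun n => iter n T v).
  move=> m n; wlog mn : m n / (m <= n)%N => [WL|].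
    by case/orP: (leq_total m n) => [/WL//|/WL mn /esym/mn].
  rewrite -{1}(subnKC mn) iterD => /(iter_inj injT)/esym fix_v.
  apply/eqP; rewrite eqn_leq mn -subn_eq0 -[_ == _]negbK -lt0n; apply/negP => nm.
  by apply: aperiodic; exists (n - m)%N.
have [s sE] : exists s : seq nat, (fun n => iter n T v) @^-1` V = [set` s].
  by apply/finite_seqP/finite_preimage => // m n _ _; exact: inj_orbit.
have sV n : V (iter n T v) -> n \in s.
  by have := congr1 (fun A : set nat => A n) sE => /= ->.
have [N noV] : exists N, forall n, (N <= n)%N -> ~ V (iter n T v).
  exists (\max_(n <- s) n).+1 => n Nn /sV sn.
  by move: Nn; rewrite ltnNge leq_bigmax_seq.
have Diter n : D (iter n T v) by elim: n => //= n; exact: TD.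
have [|k] := cover _ _ (Diter N) (Diter N.+1).
  by move/inj_orbit/eqP; rewrite ltn_eqF.
by rewrite -!iterD => -[]; apply: noV; rewrite ?addnS ?leq_addl // leqW ?leq_addl.
Qed.

(** Points of V are periodic, so by injectivity a point whose forward orbit reaches v in V lies on
    the cycle of v. Hence C is covered by finitely many cycles, and the covering hypothesis leaves
    at most one point of D outside C. *)
Lemma finite_backward_orbits (X : Type) (D V : set X) (T : X -> X) :
  injective T -> finite_set V -> V `<=` D -> {homo T : x / D x} ->
  (forall x y, D x -> D y -> x <> y -> exists k, V (iter k T x) \/ V (iter k T y)) ->
  finite_set D.
Proof.
move=> injT finV VD TD cover; pose C := [set x | exists k, V (iter k T x)].
have finC : finite_set C.
  have /choice[p pE] : forall v, exists p, V v -> (0 < p)%N /\ iter p T v = v.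
    move=> v; have [Vv|] := pselect (V v); last by exists 0%N.
    have [p p0 pv] := orbit_periodic injT finV TD cover (VD _ Vv).
    by exists p.
  apply: (@sub_finite_set _ _ (\bigcup_(v in V) ((fun n => iter n T v) @` `I_(p v)))).
    move=> x [k]; move vE: (iter k T x) => v Vv; exists v => //.
    (* Since k + k (p - 1) = k p, the point T^(k (p - 1)) v has the same k-th iterate v as x, so it
       equals x; the exponent is then reduced modulo the period. *)
    have [p0 pv] := pE _ Vv; exists ((k * (p v).-1) %% p v)%N; first by rewrite /= ltn_mod.
    have period m : iter (m %% p v) T v = iter m T v.
      by rewrite [in RHS](divn_eq m (p v)) addnC iterD iterM [iter (_ %/ _) _ _]iter_fix.
    apply: (iter_inj (n := k) injT); rewrite period -iterD -mulnS prednK // vE.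
    by rewrite iterM iter_fix.
  by apply: bigcup_finite => // v _; exact: finite_image.
have [[x [Dx Cx]]|DC] := pselect (exists x, D x /\ ~ C x); last first.
  by apply: sub_finite_set finC => x Dx; apply: contrapT => Cx; apply: DC; exists x.
apply: (@sub_finite_set _ _ (x |` C)); last by rewrite finite_setU; split.
move=> y Dy; have [->|xy] := pselect (y = x); [by left|right].
have [k [Vx|Vy]] := cover x y Dx Dy (nesym xy); last by exists k.
by case: Cx; exists k.
Qed.

(** * The action of an automorphism on maximal ideals *)

HB.instance Definition _ (R : pzRingType) (alpha : ring_aut R) :=
  GRing.isZmodMorphism.Build R R (aut_inv alpha)
    (can2_zmod_morphism (aut_funK alpha) (aut_invK alpha)).
HB.instance Definition _ (R : pzRingType) (alpha : ring_aut R) :=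
  GRing.isMonoidMorphism.Build R R (aut_inv alpha)
    (can2_monoid_morphism (aut_funK alpha) (aut_invK alpha)).

Lemma is_ideal_preimage (R S : comPzRingType) (f : {rmorphism R -> S}) (I : set S) :
  is_ideal I -> is_ideal (f @^-1` I).
Proof.
case=> I0 ID IM; split=> [|x y Ix Iy|a x Ix] /=.
- by rewrite rmorph0.
- by rewrite rmorphD; exact: ID.
- by rewrite rmorphM; exact: IM.
Qed.

(** This preimage is alpha(M); an ideal above it pulls back along alpha to an ideal above M. *)
Lemma maximal_ideal_preimage (R : comPzRingType) (alpha : ring_aut R) (M : set R) :
  maximal_ideal M -> maximal_ideal (aut_inv alpha @^-1` M).
Proof.
move=> maxM; have [Mid _ Mmax] := maxM; split; first exact: is_ideal_preimage.
  move=> MT; apply: (maximal_ideal_proper maxM).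
  suff : (aut_inv alpha @^-1` M) 1 by rewrite /= rmorph1.
  by rewrite MT.
move=> I Iid MI.
have IE : I = aut_inv alpha @^-1` (alpha @^-1` I).
  by apply/seteqP; split=> x; rewrite /= aut_invK.
have [|aM|aT] := Mmax (alpha @^-1` I) (is_ideal_preimage alpha Iid).
- by move=> x Mx; apply: MI; rewrite /= aut_funK.
- by left; rewrite IE aM.
- by right; rewrite IE aT.
Qed.

Lemma aut_iterN (R : pzRingType) (alpha : ring_aut R) (k : nat) :
  aut_iter alpha (- k%:Z) = iter k (aut_inv alpha).
Proof. by case: k. Qed.

Lemma mem_gen_prod (R : comPzRingType) (T : eqType) (s : seq T)
    (F : T -> set (set R)) (x : T -> R) :
  (forall i, i \in s -> exists2 I, F i I & I (x i)) ->
  exists2 P, gen_prod [seq F i | i <- s] P & P (\prod_(i <- s) x i).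
Proof.
rewrite /gen_prod; elim: s => [|i s IHs] Fx /=.
  by exists [set: R]; rewrite ?big_nil.
have [|P sP Px] := IHs; first by move=> j js; apply: Fx; rewrite in_cons js orbT.
have [I FI Ix] := Fx i (mem_head _ _).
rewrite !big_cons; exists (ideal_mul I P); first by exists I => //; exists P.
exists [:: (x i, \prod_(j <- s) x j)]; last by rewrite big_seq1.
by move=> q; rewrite inE => /eqP ->.
Qed.

(** [T] sends M to alpha(M). For distinct maximal M and N, a product of the alpha^(-k)(x) lies in M
    or N; by primality one factor does, which means that x lies in alpha^k(M) or alpha^k(N). *)
Lemma positively_expansive_semilocal (R : idomainType) (alpha : ring_aut R) :
  principal_ideal_domain R -> positively_expansive alpha ->
  finite_set [set M : set R | maximal_ideal M].
Proof.
move=> hR [F genF Fexp]; have [finF Fid _] := genF.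
(* A member of F escapes [M0], and this supplies the nonzero x. *)
have [M0 maxM0 _] : exists2 M0, maximal_ideal M0 & principal_ideal (0 : R) `<=` M0.
  apply: pid_exists_maximal => //; first exact: principal_ideal_ideal.
  by case=> u _ /esym/eqP; rewrite mul0r oner_eq0.
have [X FX [x Xx M0x]] := (generator_maximalP hR finF Fid).1 genF M0 maxM0.
have x0 : x != 0 by apply: contra_notN M0x => /eqP ->; have [[]] := maxM0.
pose T (M : set R) := aut_inv alpha @^-1` M.
have iterT k M : iter k T M = iter k (aut_inv alpha) @^-1` M.
  elim: k => // k IHk; rewrite iterS IHk.
  by apply/seteqP; split=> y; rewrite /T /= -iterSr.
apply: (@finite_backward_orbits _ _ [set M | maximal_ideal M /\ M x] T).
- move=> M N MN; apply/seteqP; split=> y; rewrite -[y](aut_funK alpha).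
    by move=> My; have : T M (alpha y) by []; rewrite MN.
  by move=> Ny; have : T N (alpha y) by []; rewrite -MN.
- exact: pid_maximal_containing_finite.
- by move=> M [].
- by move=> M; exact: maximal_ideal_preimage.
move=> M N maxM maxN MN.
have TV k L : maximal_ideal L -> L (aut_iter alpha (- k%:Z) x) ->
    maximal_ideal (iter k T L) /\ iter k T L x.
  move=> maxL Lx; split; last by rewrite iterT /= -aut_iterN.
  by elim: k {Lx} => //= k; exact: maximal_ideal_preimage.
have genG : generator [set M; N].
  apply/generator_maximalP => //.
    by move=> _ [->|->]; [case: maxM|case: maxN].
  have avoid A B : maximal_ideal A -> maximal_ideal B -> A <> B -> exists2 y, A y & ~ B y.
    move=> maxA maxB AB; apply: contrapT => noy; apply: AB.
    apply: maximal_ideal_sub_eq => // y Ay.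
    by apply: contrapT => By; apply: noy; exists y.
  move=> L maxL; have [ML|ML] := pselect (M = L).
    by exists N; [right|apply: avoid => // NL; apply: MN; rewrite NL].
  by exists M; [left|exact: avoid].
have [n Fn] := Fexp _ genG.
have [|P sP Px] := @mem_gen_prod R _ (iota 0 n.+1)
  (fun k => aut_gen alpha (- k%:Z) F) (fun k => aut_iter alpha (- k%:Z) x).
  by move=> k _; exists (aut_iter alpha (- k%:Z) @` X); [exists X|exists x].
have [L [->|->] PL] := Fn _ sP.
  by have [k _ Mk] := maximal_ideal_prod maxM (PL _ Px); exists k; left; exact: TV.
by have [k _ Nk] := maximal_ideal_prod maxN (PL _ Px); exists k; right; exact: TV.
Qed.

(** * The identity automorphism and the equivalence *)

Lemma aut_gen_id (R : comPzRingType) (i : int) (F : set (set R)) :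
  aut_gen (id_aut R) i F = F.
Proof.
rewrite /aut_gen (_ : aut_iter _ i = id) ?(eq_imagel (fun I _ => image_id I)) ?image_id //.
by apply/funext => x; case: i => n; exact: iter_fix.
Qed.

(** For the identity only the number of factors matters, not the exponents [f k]. *)
Lemma map_aut_gen_id (R : comPzRingType) (f : nat -> int) (n : nat) (F : set (set R)) :
  [seq aut_gen (id_aut R) (f k) F | k <- iota 0 n] = nseq n F.
Proof.
rewrite (eq_map (fun k => aut_gen_id (f k) F)).
by elim: n 0%N => //= n IHn m; rewrite IHn.
Qed.

Theorem theorem3p6 (R : idomainType) (hR : principal_ideal_domain R) :
  [<-> exists alpha : ring_aut R, positively_expansive alpha;
       expansive (id_aut R);
       finite_set [set M : set R | maximal_ideal M] ].
Proof.
tfae.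
- case=> alpha /(positively_expansive_semilocal hR)/(semilocal_generator hR).
  case=> F genF FG; exists F => // G /FG[n nG]; exists n.
  by rewrite map_aut_gen_id; apply: nG; rewrite leqW // -addnn leq_addr.
- case=> F genF FG; apply: (@positively_expansive_semilocal R (id_aut R)) => //.
  exists F => // G /FG[n]; rewrite map_aut_gen_id => nG.
  (* The windows |i| <= n and 0 <= i <= 2n have equally many terms. *)
  by exists n.*2; rewrite map_aut_gen_id.
- case/(semilocal_generator hR) => F genF FG; exists (id_aut R), F => // G /FG[n nG].
  by exists n; rewrite map_aut_gen_id; exact/nG/leqnSn.
Qed.
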